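(* Let $X$ be a $T_1$ topological space and let $Y\subseteq X$ be a subspace. The inclusion $Y\to X$ induces a closed embedding $F_q(Y)\to F_q(X)$ of free quasitopological groups (i.e. the induced homomorphism, sending each generator $y\in Y$ to $y\in X$, is a homeomorphism onto its image and its image is closed) if and only if $Y$ is closed in $X$.
   Context: Cross product: for topological spaces $X_1,X_2$, $X_1\otimes X_2$ is the set $X_1\times X_2$ with the topology in which $U$ is open iff $\{x\in X_1 : (x,y)\in U\}$ is open in $X_1$ for every $y\in X_2$ and $\{y\in X_2:(x,y)\in U\}$ is open in $X_2$ for every $x\in X_1$. $X^{\otimes n}$ is the $n$-fold iterated cross product of $X$ with itself (equivalently, $X^n$ with a set open iff each of its slices obtained by fixing all but one coordinate is open in $X$); $X^{\otimes 0}=\{e\}$ is a one-point space. For a space $Z$, $M_{st}(Z)=\coprod_{n\ge 0}Z^{\otimes n}$ (topological sum); its elements are written as words $z_1z_2\cdots z_n$, and it is a monoid under concatenation with identity the empty word $e$. For a space $X$, $X^{-1}$ is a homeomorphic copy of $X$ with elements written $x^{-1}$, and $X\sqcup X^{-1}$ is the topological sum. $F(X)$ is the free group on the set $X$, realized as the set of reduced words in $X\sqcup X^{-1}$, and $R:M_{st}(X\sqcup X^{-1})\to F(X)$ sends each word to its reduced form. The free quasitopological group $F_q(X)$ is $F(X)$ with the quotient topology induced by $R$. A subspace $Y\subseteq X$ carries the subspace topology, and $F_q(Y)$ is formed from that topology. *)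

(* Defs.v *)
From HB Require Import structures.
From mathcomp Require Import all_boot all_classical.
From mathcomp Require Import topology.

Set Implicit Arguments.
Unset Strict Implicit.
Unset Printing Implicit Defensive.

Local Open Scope classical_set_scope.

(* An alias of the product type, since X1 * X2 already carries the product
   topology. *)
Definition cross (X1 X2 : Type) : Type := (X1 * X2)%type.

Section CrossTopology.
Variables X1 X2 : topologicalType.

HB.instance Definition _ := Choice.copy (cross X1 X2) (X1 * X2)%type.

Definition cross_open (U : set (cross X1 X2)) : Prop :=
  (forall y : X2, open [set x : X1 | U (x, y)]) /\
  (forall x : X1, open [set y : X2 | U (x, y)]).

Fact cross_openT : cross_open setT.
Proof. by split=> z; exact: openT. Qed.

Fact cross_openI : setI_closed cross_open.
Proof.
move=> U V [U1 U2] [V1 V2]; split=> z.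
  exact: openI (U1 z) (V1 z).
exact: openI (U2 z) (V2 z).
Qed.

Fact cross_open_bigU (I : Type) (f : I -> set (cross X1 X2)) :
  (forall i, cross_open (f i)) -> cross_open (\bigcup_i f i).
Proof.
move=> fo; split=> z.
- by apply: (@bigcup_open _ _ setT (fun i => [set x | f i (x, z)])) => i _;
    exact: (fo i).1.
- by apply: (@bigcup_open _ _ setT (fun i => [set y | f i (z, y)])) => i _;
    exact: (fo i).2.
Qed.

HB.instance Definition _ := isOpenTopological.Build (cross X1 X2)
  cross_openT cross_openI cross_open_bigU.

End CrossTopology.

Fixpoint cross_pow (Z : topologicalType) (n : nat) : topologicalType :=
  if n is m.+1 then cross Z (cross_pow Z m) else discrete_topology unit.

(* {i : I & X i} carries the topology of the topological sum. *)
Notation Mst Z := {n : nat & cross_pow Z n}.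

Section Words.
Variable Z : topologicalType.

Fixpoint cross_pow_seq (n : nat) : cross_pow Z n -> seq Z :=
  if n is m.+1 then fun p => p.1 :: cross_pow_seq p.2 else fun=> [::].

Definition word (w : Mst Z) : seq Z := cross_pow_seq (projT2 w).

Fixpoint cross_pow_of_seq (s : seq Z) : cross_pow Z (size s) :=
  if s is z :: s' then (z, cross_pow_of_seq s') else tt.

Definition Mst_of_seq (s : seq Z) : Mst Z :=
  existT _ (size s) (cross_pow_of_seq s).

Lemma Mst_of_seqK : cancel Mst_of_seq word.
Proof. by rewrite /Mst_of_seq /word; elim=> //= z s /= ->. Qed.

Lemma wordK : cancel word Mst_of_seq.
Proof.
rewrite /Mst_of_seq /word => -[n]; elim: n => [|n IHn] /=; first by case.
case=> z p /=; move: (IHn p) => /= e.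
exact: (f_equal (fun w : Mst Z =>
  existT (cross_pow Z) (projT1 w).+1 (z, projT2 w)) e).
Qed.

Lemma size_cross_pow_seq n (p : cross_pow Z n) : size (cross_pow_seq p) = n.
Proof. by elim: n p => //= n IHn [z p] /=; rewrite IHn. Qed.

Lemma open_cross_powP n (U : set (seq Z)) :
  open ([set p | U (cross_pow_seq p)] : set (cross_pow Z n)) <->
  forall s1 s2, (size s1 + size s2).+1 = n ->
    open [set z | U (s1 ++ z :: s2)].
Proof.
elim: n U => [|n IHn] U.
  by split=> // _; exact: discrete_open.
split.
- move=> [U1 U2] [|x s1] s2 /= [es].
    move: (U1 (ecast k (cross_pow Z k) es (cross_pow_of_seq s2))) => /=.
    congr open; apply/funext => z /=; congr (U (z :: _)).
    by case: n / es {IHn U U1 U2}; exact: (Mst_of_seqK s2).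
  have /(IHn (fun s => U (x :: s))) := U2 x.
  by apply.
- move=> oU; split=> [p|x] /=.
    by apply: (oU [::] (cross_pow_seq p)); rewrite /= size_cross_pow_seq.
  by apply/(IHn (fun s => U (x :: s))) => s1 s2 es; apply: (oU (x :: s1));
    rewrite /= -es addSn.
Qed.

(* A set of words is open iff all its one-letter slices are open. *)
Lemma open_MstP (U : set (seq Z)) :
  open (word @^-1` U) <-> forall s1 s2, open [set z | U (s1 ++ z :: s2)].
Proof.
rewrite sigT_openP; split=> [oU s1 s2|oU n].
  by have /open_cross_powP := oU (size s1 + size s2).+1; apply.
by apply/open_cross_powP => s1 s2 _; exact: oU.
Qed.

End Words.

(* The topological sum of X and X^-1: (true, x) is the letter x and
   (false, x) is the letter x^-1. *)
Notation letter X := {_ : bool & X}.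

Definition letterV (X : Type) (a : letter X) : letter X :=
  existT _ (~~ projT1 a) (projT2 a).

Definition letter_map (X X' : Type) (f : X -> X') (a : letter X) : letter X' :=
  existT _ (projT1 a) (f (projT2 a)).

Lemma letterVK (X : Type) : involutive (@letterV X).
Proof. by case=> b x; rewrite /letterV /= negbK. Qed.

Section Reduction.
Variable X : choiceType.
Implicit Types (a b : letter X) (s t u : seq (letter X)).

Definition reduced s : bool := sorted (fun a b => b != letterV a) s.

Definition reduce_cons a s : seq (letter X) :=
  if s is b :: s' then if b == letterV a then s' else a :: s else [:: a].

Definition reduce s : seq (letter X) := foldr reduce_cons [::] s.

Lemma reduced_cons a s : reduced (a :: s) -> reduced s.
Proof. by case: s => //= b s /andP[]. Qed.

Lemma reduce_cons_reduced a s : reduced s -> reduced (reduce_cons a s).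
Proof.
case: s => //= b s rs; case: ifPn => /= ba; last by rewrite ba.
exact: (@reduced_cons b).
Qed.

Lemma foldr_reduced s t : reduced t -> reduced (foldr reduce_cons t s).
Proof. by move=> rt; elim: s => //= a s; exact: reduce_cons_reduced. Qed.

Lemma reduce_reduced s : reduced (reduce s).
Proof. exact: foldr_reduced. Qed.

Lemma reduce_id s : reduced s -> reduce s = s.
Proof.
elim: s => //= a s IHs ras; rewrite IHs; last exact: (@reduced_cons a).
by case: s ras {IHs} => //= b s /andP[/negPf->].
Qed.

Lemma reduce_consK a s : reduced s ->
  reduce_cons a (reduce_cons (letterV a) s) = s.
Proof.
case: s => [|b s] /=; first by rewrite eqxx.
rewrite letterVK; case: eqVneq => [->|ba] /=; last by rewrite eqxx.
by case: s => //= c s /andP[/negPf->].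
Qed.

Lemma foldr_reduce_cons a s t : reduced t ->
  foldr reduce_cons t (reduce_cons a s) = reduce_cons a (foldr reduce_cons t s).
Proof.
move=> rt; case: s => //= b s; case: eqP => [->|//].
by rewrite reduce_consK// foldr_reduced.
Qed.

Lemma foldr_reduce s t : reduced t ->
  foldr reduce_cons t (reduce s) = foldr reduce_cons t s.
Proof.
by move=> rt; elim: s => //= a s IHs; rewrite foldr_reduce_cons// IHs.
Qed.

Lemma reduce_catl s t : reduce (reduce s ++ t) = reduce (s ++ t).
Proof. by rewrite /reduce !foldr_cat foldr_reduce// reduce_reduced. Qed.

Lemma reduce_catr s t : reduce (s ++ reduce t) = reduce (s ++ t).
Proof.
by rewrite /reduce !foldr_cat -/(reduce (reduce t)) reduce_id ?reduce_reduced.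
Qed.

Lemma reduce_cancel s a t : reduce (s ++ a :: letterV a :: t) = reduce (s ++ t).
Proof. by rewrite /reduce !foldr_cat /= reduce_consK// reduce_reduced. Qed.

Definition wordV s : seq (letter X) := rev (map (@letterV X) s).

Lemma wordVK : involutive wordV.
Proof.
by move=> s; rewrite /wordV map_rev revK -map_comp map_id_in // => a _ /=;
  rewrite letterVK.
Qed.

Lemma reduce_catV s : reduce (s ++ wordV s) = [::].
Proof.
suff H t : reduce (s ++ wordV s ++ t) = reduce t by rewrite -[wordV s]cats0 H.
elim: s t => //= a s IHs t.
rewrite /wordV /= rev_cons cat_rcons -/(wordV s) IHs.
exact: reduce_consK (reduce_reduced t).
Qed.

End Reduction.

Record free_group (X : choiceType) : Type := FreeGroup {
  fg_word :> seq (letter X);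
  fg_wordP : reduced fg_word }.

HB.instance Definition _ (X : choiceType) := [isSub for @fg_word X].
HB.instance Definition _ (X : choiceType) := [Choice of free_group X by <:].

Definition fg_reduce (X : choiceType) (s : seq (letter X)) : free_group X :=
  FreeGroup (reduce_reduced s).

Definition fg_gen (X : choiceType) (x : X) : free_group X :=
  fg_reduce [:: existT _ true x].

Lemma fg_word_inj (X : choiceType) : injective (@fg_word X).
Proof. exact: val_inj. Qed.

Section FreeGroupOps.
Variable X : choiceType.
Implicit Types u v w : free_group X.

Definition fg_one : free_group X := fg_reduce [::].
Definition fg_mul u v : free_group X := fg_reduce (u ++ v).
Definition fg_inv u : free_group X := fg_reduce (wordV u).

Lemma fg_wordK : cancel (@fg_word X) (@fg_reduce X).
Proof. by move=> u; apply: val_inj; exact: (reduce_id (fg_wordP u)). Qed.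

Lemma fg_mulA : associative fg_mul.
Proof.
by move=> u v w; apply: val_inj; rewrite /= reduce_catr reduce_catl catA.
Qed.

Lemma fg_mul1g : left_id fg_one fg_mul.
Proof. by move=> u; exact: fg_wordK. Qed.

Lemma fg_mulg1 : right_id fg_one fg_mul.
Proof. by move=> u; rewrite /fg_mul /= cats0; exact: fg_wordK. Qed.

Lemma fg_mulgV : right_inverse fg_one fg_inv fg_mul.
Proof.
by move=> u; apply: val_inj; rewrite /= reduce_catr reduce_catV.
Qed.

Lemma fg_mulVg : left_inverse fg_one fg_inv fg_mul.
Proof.
move=> u; apply: val_inj; rewrite /= reduce_catl.
by rewrite -{2}(wordVK u) reduce_catV.
Qed.

HB.instance Definition _ := isGroup.Build (free_group X)
  fg_mulA fg_mul1g fg_mulg1 fg_mulVg fg_mulgV.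

End FreeGroupOps.

Section FreeQuasitopologicalGroup.
Variable X : topologicalType.

Definition Mst_reduce (w : Mst (letter X)) : free_group X :=
  fg_reduce (word w).

Definition Mst_of_fg (u : free_group X) : Mst (letter X) :=
  Mst_of_seq (fg_word u).

Lemma Mst_of_fgK : cancel Mst_of_fg Mst_reduce.
Proof. by move=> u; rewrite /Mst_reduce Mst_of_seqK; exact: fg_wordK. Qed.

HB.instance Definition _ := isQuotient.Build _ (free_group X) Mst_of_fgK.

(* Pitfall: on Fq the generic val denotes the section into Mst (letter X) coming
   from the quotient structure, not fg_word. *)
Definition Fq : Type := quotient_topology (free_group X).

HB.instance Definition _ := Topological.on Fq.
HB.instance Definition _ := isGroup.Build Fq
  (@fg_mulA X) (@fg_mul1g X) (@fg_mulg1 X) (@fg_mulVg X) (@fg_mulgV X).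

Lemma open_FqP (U : set Fq) : open U <-> open (Mst_reduce @^-1` U).
Proof. by rewrite {1}/open /= /quotient_open pi.unlock. Qed.

End FreeQuasitopologicalGroup.

Section InducedHomomorphism.
Variables X X' : topologicalType.
Variable f : X -> X'.

Definition Fq_map (u : Fq X) : Fq X' :=
  fg_reduce (map (letter_map f) (fg_word u)).

Lemma reduce_map s :
  reduce (map (letter_map f) (reduce s)) = reduce (map (letter_map f) s).
Proof.
elim: s => //= a s <-; case: (reduce s) (reduce_reduced s) => //= b t rbt.
case: eqP => [->|//]; symmetry.
exact: reduce_consK (reduce_reduced _).
Qed.

Lemma Fq_map_morphism : monoid_morphism Fq_map.
Proof.
split; first exact: fg_word_inj.
move=> u v; apply: fg_word_inj.
rewrite -[LHS]/(reduce (map _ (reduce (_ ++ _)))).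
by rewrite reduce_map map_cat -[RHS]/(reduce (reduce _ ++ reduce _))
  reduce_catl reduce_catr.
Qed.

HB.instance Definition _ := isUMagmaMorphism.Build (Fq X) (Fq X') Fq_map
  Fq_map_morphism.

Lemma Fq_map_gen (x : X) : Fq_map (fg_gen x) = fg_gen (f x).
Proof. exact: fg_word_inj. Qed.

Lemma Fq_map_unique (phi : Fq X -> Fq X') : monoid_morphism phi ->
  (forall x, phi (fg_gen x) = fg_gen (f x)) -> phi =1 Fq_map.
Proof.
move=> [phi1 phiM] phi_gen u; rewrite -[u]fg_wordK; move: (fg_word u) => {u} s.
pose g s : Fq X := fg_reduce s.
suff phiE a : phi (g [:: a]) = Fq_map (g [:: a]).
  rewrite -/(g s); elim: s => [|a s IHs].
    by rewrite phi1; exact: fg_word_inj.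
  have -> : g (a :: s) = (g [:: a] * g s)%g.
    by apply: fg_word_inj; exact: (esym (reduce_catr [:: a] s)).
  by rewrite phiM IHs phiE -Fq_map_morphism.2.
have phi_true x :
    phi (g [:: existT _ true x]) = Fq_map (g [:: existT _ true x]).
  by rewrite phi_gen -Fq_map_gen.
case: a => -[] x //.
have gV : g [:: existT _ false x] = (g [:: existT _ true x])^-1%g.
  exact: fg_word_inj.
have phiV (psi : Fq X -> Fq X') v : monoid_morphism psi ->
    psi (v^-1)%g = ((psi v)^-1)%g.
  move=> [psi1 psiM]; apply/eqP.
  by rewrite -mulg_eq1 -psiM mulVg psi1.
by rewrite gV !phiV ?phi_true//; exact: Fq_map_morphism.
Qed.

End InducedHomomorphism.

Definition homeomorphism (A B : topologicalType) (f : A -> B) : Prop :=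
  continuous f /\ exists g : B -> A, [/\ cancel f g, cancel g f & continuous g].

(* set_type (range f) carries the subspace topology. *)
Definition corestriction (A B : Type) (f : A -> B) (a : A) :
  set_type (range f) := SigSub (mem_set (imageT f a)).

Definition closed_embedding (A B : topologicalType) (f : A -> B) : Prop :=
  homeomorphism (corestriction f) /\ closed (range f).

(* Main.v *)
Require Import Defs.
From mathcomp Require Import all_boot all_classical.
From mathcomp Require Import topology.

(** A set is closed in [Fq X] iff each of its one-letter slices
    {x : the class of s1 x^e s2 lies in the set}, with e = 1 or e = -1, is
    closed in X, and it is enough to test slices along reduced words s1, s2.
    This reduces everything to a remark about words: if s1 and s2 are reduced
    and x is not one of their finitely many letters, then s1 x^e s2 is reduced
    ([reduced_insert]).

    Let f : X -> X' be a closed injection into a T1 space and let C be closed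
    in [Fq X]. Consider the slice of the image of C along s1, s2. If all the
    letters of s1 and s2 come from X, then an x outside the range of f cannot
    cancel, so the slice is exactly the image under f of a slice of C, and it is
    closed because f is a closed map. Otherwise s1 or s2 has a letter that is
    not in the range of f, and the class of s1 x^e s2 can lie in the image of
    F(X) only if some cancellation takes place; hence x is a letter of s1 or s2,
    and the slice is finite, so closed by T1. Therefore the induced homomorphism
    is a closed map ([Fq_map_closed]); it is also continuous and injective,
    hence a closed embedding. The inclusion of a closed subspace is such an f.

    Conversely the insertion of generators X -> [Fq X] is continuous, and the
    generators that lie in the image of F(Y) are those of Y, so Y is the
    preimage of a closed set. *)

Set Implicit Arguments.
Unset Strict Implicit.
Unset Printing Implicit Defensive.

Local Open Scope classical_set_scope.

(** * Reduced words *)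

Definition letter_point (X : Type) (a : letter X) : X := projT2 a.

Section ReducedWords.
Variable X : choiceType.
Implicit Types (a : letter X) (s : seq (letter X)).

(** Cancelling forces two adjacent letters to be powers of the same generator,
    so a letter over a new generator leaves both its neighbours alone. *)
Lemma reduced_insert s1 s2 a : reduced s1 -> reduced s2 ->
    letter_point a \notin map (@letter_point _) (s1 ++ s2) ->
  reduced (s1 ++ a :: s2).
Proof.
have neqV b c : letter_point b != letter_point c -> c != letterV b.
  by apply: contraNneq => ->.
move=> rs1 rs2; rewrite map_cat mem_cat negb_or => /andP[as1 as2].
rewrite /reduced sorted_cat_cons; apply/andP; split.
  case: s1 rs1 as1 => //= b s1 rs1 as1; rewrite rcons_path rs1 /=.
  apply: neqV; apply: contraNneq as1 => <-.
  by rewrite -[_ :: map _ _]/(map _ (b :: s1)) map_f// mem_last.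
case: s2 rs2 as2 => //= b s2 -> /[!inE] /norP[ab _]; rewrite andbT.
exact: neqV.
Qed.

Lemma reduce_insert s1 a s2 :
  reduce (reduce s1 ++ a :: reduce s2) = reduce (s1 ++ a :: s2).
Proof.
by rewrite reduce_catl -cat_rcons reduce_catr cat_rcons.
Qed.

End ReducedWords.

Section MapWords.
Variables (X X' : choiceType) (f : X -> X').
Hypothesis finj : injective f.

Lemma letter_map_inj : injective (letter_map f).
Proof. by move=> [b x] [c y] [-> /finj->]. Qed.

Lemma reduced_map s : reduced (map (letter_map f) s) = reduced s.
Proof.
rewrite /reduced sorted_map; apply: eq_sorted => a b /=.
by rewrite -(inj_eq letter_map_inj b).
Qed.

End MapWords.

(** * The topology of the free quasitopological group *)

Section ClosedSlices.
Variable X : topologicalType.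

Lemma closed_FqP (C : set (Fq X)) :
  closed C <-> forall b s1 s2,
    closed [set x | C (fg_reduce (s1 ++ existT _ b x :: s2))].
Proof.
rewrite -openC open_FqP.
rewrite (@open_MstP (letter X) (fun s : seq (letter X) => ~ C (fg_reduce s))).
split=> [oC b s1 s2|cC s1 s2].
  by have /sigT_openP/(_ b) := oC s1 s2; rewrite -openC.
by apply/sigT_openP => b; have := cC b s1 s2; rewrite -openC.
Qed.

(** The slice along s1, s2 depends only on the reduced forms of s1 and s2. *)
Lemma closed_Fq_reduced (C : set (Fq X)) :
  (forall b s1 s2, reduced s1 -> reduced s2 ->
    closed [set x | C (fg_reduce (s1 ++ existT _ b x :: s2))]) ->
  closed C.
Proof.
move=> cC; apply/closed_FqP => b s1 s2.
have := cC b _ _ (reduce_reduced s1) (reduce_reduced s2).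
congr closed; apply/funext => x /=; congr C; apply: fg_word_inj.
exact: reduce_insert.
Qed.

Lemma fg_gen_continuous : continuous (@fg_gen X : X -> Fq X).
Proof.
by apply/continuous_closedP => C /closed_FqP/(_ true [::] [::]).
Qed.

End ClosedSlices.

(** * The induced homomorphism *)

Section InducedMap.
Variables (X X' : topologicalType) (f : X -> X').

Lemma Fq_map_reduce s :
  Fq_map f (fg_reduce s) = fg_reduce (map (letter_map f) s).
Proof. by apply: fg_word_inj; exact: reduce_map. Qed.

Lemma Fq_map_continuous : continuous f -> continuous (Fq_map f).
Proof.
move=> cf; apply/continuous_closedP => C /closed_FqP cC.
apply/closed_FqP => b s1 s2.
have /continuous_closedP/(_ _ (cC b (map (letter_map f) s1)
  (map (letter_map f) s2))) := cf.
by congr closed; apply/funext => x /=; rewrite Fq_map_reduce map_cat.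
Qed.

Hypothesis finj : injective f.

Lemma fg_word_Fq_map u :
  fg_word (Fq_map f u) = map (letter_map f) (fg_word u).
Proof. by rewrite /= reduce_id// (reduced_map finj) fg_wordP. Qed.

Lemma Fq_map_inj : injective (Fq_map f).
Proof.
move=> u v /(congr1 (@fg_word _)); rewrite !fg_word_Fq_map.
by move=> /(inj_map (letter_map_inj finj))/fg_word_inj.
Qed.

(** This is where the T1 axiom enters: it makes closed the finite set of those
    x that can cancel against a letter of s1 or s2. *)
Lemma Fq_map_closed (C : set (Fq X)) : accessible_space X' ->
    (forall A, closed A -> closed (f @` A)) ->
  closed C -> closed (Fq_map f @` C).
Proof.
move=> T1 closedf /closed_FqP cC.
apply: closed_Fq_reduced => b s1 s2 rs1 rs2.
have image_letters x u : x \notin map (@letter_point _) (s1 ++ s2) ->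
    Fq_map f u = fg_reduce (s1 ++ existT _ b x :: s2) ->
    map (letter_map f) (fg_word u) = s1 ++ existT _ b x :: s2.
  move=> xs uE; rewrite -fg_word_Fq_map uE /= reduce_id//.
  exact: reduced_insert.
have [[t1 [t2 [s1E s2E]]]|nt] := pselect (exists t1 t2,
    s1 = map (letter_map f) t1 /\ s2 = map (letter_map f) t2).
- have := closedf _ (cC b t1 t2); congr closed.
  have fE y : Fq_map f (fg_reduce (t1 ++ existT _ b y :: t2)) =
      fg_reduce (s1 ++ existT _ b (f y) :: s2).
    by rewrite Fq_map_reduce map_cat s1E s2E.
  apply/seteqP; split=> [_ [y Cy <-]|x [u Cu uE]] /=.
    by exists (fg_reduce (t1 ++ existT _ b y :: t2)).
  (* Either x is a letter of s1 or s2, which come from X, or x survives the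
     reduction and is itself a letter of the image of u. *)
  have [y fyx] : exists y, f y = x.
    have [xs|xs] := boolP (x \in map (@letter_point _) (s1 ++ s2)).
      move: xs; rewrite s1E s2E -map_cat -map_comp => /mapP[a _ ->].
      by exists (letter_point a).
    have : existT _ b x \in map (letter_map f) (fg_word u).
      by rewrite (image_letters x u)// mem_cat mem_head orbT.
    by move=> /mapP[a _ /(congr1 (@letter_point _)) /= ->]; exists (letter_point a).
  exists y => //; rewrite -fyx -fE in uE.
  by rewrite /= -(Fq_map_inj uE).
- (* If x did not cancel, cutting the image of u at x would exhibit s1 and s2
     as images, contrary to nt. *)
  apply: (accessible_finite_set_closed.1 T1).
  apply: sub_finite_set (finite_seq (map (@letter_point _) (s1 ++ s2))).
  move=> x [u Cu uE] /=; apply: contrapT => /negP xs; apply: nt.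
  have uw := image_letters x u xs uE.
  exists (take (size s1) (fg_word u)), (drop (size s1).+1 (fg_word u)).
  rewrite map_take map_drop uw take_size_cat//; split=> //.
  by rewrite -cat_rcons drop_size_cat// size_rcons.
Qed.

End InducedMap.

(** * Closed embeddings *)

Lemma closed_embedding_closed_map (A B : topologicalType) (f : A -> B) :
  continuous f -> injective f ->
  (forall C, closed C -> closed (f @` C)) -> closed_embedding f.
Proof.
move=> fcont finj closedf; split; last exact: closedf closedT.
split.
  apply/continuousP => _ [U oU <-].
  by have /continuousP/(_ _ oU) := fcont.
have ex (w : set_type (range f)) : exists a, f a = set_val w.
  by have /set_mem[a _ fa] := valP w; exists a.
pose g w := projT1 (cid (ex w)).
have gK w : f (g w) = set_val w := projT2 (cid (ex w)).
exists g; split.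
- by move=> a; apply: finj; rewrite gK.
- by move=> w; apply: val_inj; exact: gK.
- apply/continuous_closedP => C cC.
  have -> : g @^-1` C = set_val @^-1` (f @` C).
    apply/seteqP; split=> w /=; first by exists (g w).
    by move=> [a Ca]; rewrite -gK => /finj <-.
  apply: preimage_closed (closedf _ cC) => w _.
  exact: initial_continuous.
Qed.

Lemma closed_set_val_image (X : topologicalType) (Y : set X)
    (A : set (set_type Y)) :
  closed Y -> closed A -> closed (set_val @` A).
Proof.
move=> cY; rewrite -openC => -[U oU UA].
have -> : set_val @` A = Y `&` ~` U.
  have UE y : U (set_val y) <-> ~ A y by rewrite -[~ A y]/((~` A) y) -UA.
  apply/seteqP; split=> [_ [y Ay <-]|x [Yx nUx]].
    split; first exact: set_mem (valP y).
    by move/UE.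
  exists (SigSub (mem_set Yx)) => //; apply: contrapT => nA.
  by apply: nUx; apply: (UE (SigSub (mem_set Yx))).2.
by apply: closedI cY _; exact: open_closedC.
Qed.

Theorem theorem1p2 (X : topologicalType) (Y : set X)
    (T1 : accessible_space X) :
  closed_embedding (Fq_map (set_val : set_type Y -> X)) <-> closed Y.
Proof.
have vinj : injective (set_val : set_type Y -> X) := val_inj.
split=> [[_ cF]|cY].
  have -> : Y = @fg_gen X @^-1` range (Fq_map (set_val : set_type Y -> X)).
    apply/seteqP; split=> [x Yx|x [u _ uE]].
      by exists (fg_gen (SigSub (mem_set Yx) : set_type Y)).
    have : existT _ true x \in
        map (letter_map (set_val : set_type Y -> X)) (fg_word u).
      by rewrite -(fg_word_Fq_map vinj) uE mem_head.
    by move=> /mapP[a _ [_ ->]]; exact: set_mem (valP (letter_point a)).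
  by have /continuous_closedP := @fg_gen_continuous X; exact.
apply: closed_embedding_closed_map.
- by apply: Fq_map_continuous; exact: initial_continuous.
- exact: Fq_map_inj.
- move=> C; apply: Fq_map_closed => // A.
  exact: closed_set_val_image.
Qed.
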